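(* (Composition-Diamond lemma for $\Omega$-algebras) Let $k$ be a field, $X$ a set, $\Omega=\bigcup_{n\ge 1}\Omega_n$ a set of operation symbols ($\Omega_n$ being the $n$-ary ones), $k(X,\Omega)$ the free $\Omega$-algebra over $k$ generated by $X$, $>$ a monomial ordering on the set $(X,\Omega)$ of $\Omega$-words, $S\subset k(X,\Omega)$ a set of monic $\Omega$-polynomials, and $Id(S)$ the $\Omega$-ideal of $k(X,\Omega)$ generated by $S$. Then the following statements are equivalent: (I) $S$ is a Gröbner-Shirshov basis in $k(X,\Omega)$. (II) For every nonzero $f\in Id(S)$, one has $\bar f=u|_{\bar s}$ for some $s\in S$ and some $\star$-$\Omega$-word $u$. (III) The set $Irr(S)=\{\omega\in (X,\Omega)\mid \omega\ne u|_{\bar s}\text{ for all } s\in S \text{ and all } \star\text{-}\Omega\text{-words } u\}$ is a $k$-basis of the quotient algebra $k(X,\Omega|S)=k(X,\Omega)/Id(S)$.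
   Context: $\Omega$-words: $(X,\Omega)$ is the smallest set of formal expressions containing $X$ and containing $\delta(u_1,\dots,u_t)$ whenever $\delta\in\Omega_t$ ($t\ge 1$) and $u_1,\dots,u_t\in(X,\Omega)$. $k(X,\Omega)$ is the $k$-vector space with basis $(X,\Omega)$, with each $\delta\in\Omega_t$ extended $t$-linearly; its elements are called $\Omega$-polynomials. A $\star$-$\Omega$-word is an element of $(X\cup\{\star\},\Omega)$ (where $\star\notin X$) in which $\star$ occurs exactly once. For a $\star$-$\Omega$-word $u$ and $s\in k(X,\Omega)$, $u|_s$ denotes the result of substituting $s$ for $\star$ in $u$ (an ''$s$-$\Omega$-word''). A monomial ordering $>$ on $(X,\Omega)$ is a well ordering such that for all $u,v\in(X,\Omega)$ and every $\star$-$\Omega$-word $w$, $u>v$ implies $w|_u>w|_v$. For $0\ne f\in k(X,\Omega)$, $\bar f$ is the largest $\Omega$-word occurring in $f$ with nonzero coefficient; $f$ is monic if this coefficient is $1$. An $\Omega$-ideal is a $k$-subspace $I\subseteq k(X,\Omega)$ such that $u|_f\in I$ for all $f\in I$ and all $\star$-$\Omega$-words $u$. For monic $f,g$, if $w=\bar f=u|_{\bar g}$ for some $\star$-$\Omega$-word $u$, then $(f,g)_w=f-u|_g$ is called the (inclusion) composition of $f$ and $g$ with respect to $w$. For a set $S$ of monic $\Omega$-polynomials, $(f,g)_w$ is trivial modulo $(S,w)$ if $(f,g)_w=\sum_i\alpha_i u_i|_{s_i}$ (finite sum) with $\alpha_i\in k$, $u_i$ $\star$-$\Omega$-words, $s_i\in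 S$ and $u_i|_{\overline{s_i}}<w$. $S$ is a Gröbner-Shirshov basis in $k(X,\Omega)$ if for all $f,g\in S$ every composition $(f,g)_w$ is trivial modulo $(S,w)$. *)

(* Defs.v *)
From HB Require Import structures.
From mathcomp Require Import all_boot all_order all_algebra finmap.
From mathcomp Require Import boolp classical_sets.
From mathcomp Require Import monalg.

Set Implicit Arguments.
Unset Strict Implicit.
Unset Printing Implicit Defensive.

Import GRing.Theory.

Local Open Scope quotient_scope.
Local Open Scope ring_scope.

(* [Omega t] is the type of t-ary operation symbols; only the arities t >= 1
   are used, so there are no constants and [word Omega X] may be empty. *)
Inductive word (Omega : nat -> Type) (X : Type) : Type :=
| Var of X
| Op n of Omega n.+1 & {ffun 'I_n.+1 -> word Omega X}.

Arguments Var {Omega X} x.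
Arguments Op {Omega X n} d u.

HB.instance Definition _ Omega X := gen_eqMixin (word Omega X).
HB.instance Definition _ Omega X := gen_choiceMixin (word Omega X).

(* Interpretation of words in a set A carrying operations of signature Omega. *)
Fixpoint interp (Omega : nat -> Type) (Y A : Type)
    (op : forall n, Omega n.+1 -> ('I_n.+1 -> A) -> A) (v : Y -> A)
    (w : word Omega Y) : A :=
  match w with
  | Var y => v y
  | Op n d u => op n d (fun i => interp op v (u i))
  end.

(* In [option X], the letter [None] plays the role of the symbol star. *)
Definition star_count Omega X (u : word Omega (option X)) : nat :=
  interp (fun n _ (c : 'I_n.+1 -> nat) => (\sum_i c i)%N)
         (fun y => if y is None then 1%N else 0%N) u.

Definition star_word Omega X :=
  {u : word Omega (option X) | star_count u = 1%N}.

Definition wsubst Omega X (u : star_word Omega X) (v : word Omega X) :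
    word Omega X :=
  interp (fun n d a => Op d (finfun a)) (fun y => if y is Some x then Var x else v)
         (sval u).

Definition opoly (k : fieldType) Omega X := {malg k[word Omega X]}.

HB.instance Definition _ k Omega X :=
  GRing.Lmodule.copy (opoly k Omega X) {malg k[word Omega X]}.

(* Multilinear extension of an operation symbol: the product of the linear
   expansions of the arguments is expanded over all choices of one word in the
   support of each argument. *)
Definition opoly_op k Omega X n (d : Omega n.+1)
    (f : 'I_n.+1 -> opoly k Omega X) : opoly k Omega X :=
  \sum_(w : {dffun forall i : 'I_n.+1, msupp (f i)})
    << \prod_i (f i)@_(val (w i)) *g Op d [ffun i => val (w i)] >>.

Definition psubst k Omega X (u : star_word Omega X) (s : opoly k Omega X) :
    opoly k Omega X :=
  interp (@opoly_op k Omega X) (fun y => if y is Some x then << Var x >> else s)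
         (sval u).

(* [lt v u] stands for u > v. *)
Record monomial_order Omega X (lt : word Omega X -> word Omega X -> Prop) :
    Prop := MonomialOrder {
  mo_trans : forall u v w, lt u v -> lt v w -> lt u w;
  mo_total : forall u v, u <> v -> lt u v \/ lt v u;
  mo_wf : well_founded lt;
  mo_subst : forall u v (w : star_word Omega X),
    lt v u -> lt (wsubst w v) (wsubst w u)
}.

Section GroebnerShirshov.

Variables (k : fieldType) (Omega : nat -> Type) (X : Type).
Variable lt : word Omega X -> word Omega X -> Prop.

Implicit Types (f g s : opoly k Omega X) (w : word Omega X).
Implicit Types (S I : set (opoly k Omega X)) (u : star_word Omega X).

(* Graph of the partial function sending a nonzero f to its leading word. *)
Definition leading f w : Prop :=
  w \in msupp f /\ forall v, v \in msupp f -> v <> w -> lt v w.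

Definition omonic f : Prop := exists w, leading f w /\ f@_w = 1.

Definition composition f g w h : Prop :=
  exists u gbar, [/\ leading f w, leading g gbar, w = wsubst u gbar
                   & h = f - psubst u g].

Definition trivial_mod S w h : Prop :=
  exists (m : nat) (a : 'I_m -> k) (u : 'I_m -> star_word Omega X)
         (s : 'I_m -> opoly k Omega X),
    (forall i, S (s i) /\
       exists sbar, leading (s i) sbar /\ lt (wsubst (u i) sbar) w) /\
    h = \sum_i a i *: psubst (u i) (s i).

Definition groebner_shirshov S : Prop :=
  forall f g w h, S f -> S g -> composition f g w h -> trivial_mod S w h.

Definition omega_ideal I : Prop :=
  [/\ I 0, forall (a : k) f g, I f -> I g -> I (a *: f + g)
    & forall f u, I f -> I (psubst u f)].

Definition ideal_gen S : set (opoly k Omega X) :=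
  [set f | forall I, omega_ideal I -> (S `<=` I)%classic -> I f]%classic.

Definition irr S : set (word Omega X) :=
  [set w | ~ exists s u sbar,
       [/\ S s, leading s sbar & w = wsubst u sbar]]%classic.

End GroebnerShirshov.

Section Quotient.

Variables (k : fieldType) (Omega : nat -> Type) (X : Type).
Variable S : set (opoly k Omega X).

Implicit Types f g : opoly k Omega X.

Definition ideal_pred : {pred opoly k Omega X} := fun f => `[< ideal_gen S f >].

Fact ideal_pred_submod : submod_closed ideal_pred.
Proof.
split; first by apply/asboolP => I [].
move=> a f g /asboolP Sf /asboolP Sg; apply/asboolP => I idI SI.
by case: (idI) => _ lin _; apply: lin; [apply: Sf | apply: Sg].
Qed.

HB.instance Definition _ :=
  GRing.isSubmodClosed.Build k (opoly k Omega X) ideal_pred ideal_pred_submod.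

(* k(X, Omega | S): the library provides the additive quotient group, to which
   the scaling induced by that of [opoly] is added. *)
Definition opoly_quot : Type := @Quotient.quot (opoly k Omega X) ideal_pred.

HB.instance Definition _ := GRing.Zmodule.on opoly_quot.

Definition opoly_class f : opoly_quot := \pi_(opoly_quot) f.

Definition quot_scale (a : k) (x : opoly_quot) : opoly_quot :=
  opoly_class (a *: repr x).

Lemma opoly_classP f g : reflect (opoly_class f = opoly_class g)
                                 (`[< ideal_gen S (f - g) >]).
Proof.
by have := Quotient.idealrBE ideal_pred f g; rewrite unfold_in => ->; apply: eqP.
Qed.

Lemma opoly_classK x : opoly_class (repr x) = x.
Proof. exact: reprK. Qed.

Lemma opoly_classD f g : opoly_class (f + g) = opoly_class f + opoly_class g.
Proof. exact: Quotient.pi_add. Qed.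

Lemma quot_scale_class a f : quot_scale a (opoly_class f) = opoly_class (a *: f).
Proof.
apply/opoly_classP; rewrite -scalerBr -/(_ \in ideal_pred).
have : repr (opoly_class f) - f \in ideal_pred.
  by apply/opoly_classP; rewrite opoly_classK.
exact: rpredZ.
Qed.

Fact quot_scaleA a b x : quot_scale a (quot_scale b x) = quot_scale (a * b) x.
Proof. by rewrite -[x]opoly_classK !quot_scale_class scalerA. Qed.

Fact quot_scale1 : left_id 1 quot_scale.
Proof. by move=> x; rewrite -[x]opoly_classK quot_scale_class scale1r. Qed.

Fact quot_scaleDr : right_distributive quot_scale +%R.
Proof.
move=> a x y; rewrite -[x]opoly_classK -[y]opoly_classK -opoly_classD.
by rewrite !quot_scale_class scalerDr opoly_classD.
Qed.

Fact quot_scaleDl x : {morph quot_scale^~ x : a b / a + b}.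
Proof.
by move=> a b; rewrite -[x]opoly_classK !quot_scale_class scalerDl opoly_classD.
Qed.

HB.instance Definition _ := GRing.Zmodule_isLmodule.Build k opoly_quot
  quot_scaleA quot_scale1 quot_scaleDr quot_scaleDl.

End Quotient.

Section Basis.

Variables (k : fieldType) (V : lmodType k) (J : choiceType) (b : J -> V).

Definition lincomb (c : {malg k[J]}) : V := \sum_(j <- msupp c) c@_j *: b j.

Definition is_basis : Prop :=
  (forall c, lincomb c = 0 -> c = 0) /\ (forall v, exists c, v = lincomb c).

End Basis.

(* Main.v *)
From HB Require Import structures.
Require Import Defs.
From mathcomp Require Import all_boot all_order all_algebra finmap.
From mathcomp Require Import boolp classical_sets.
From mathcomp Require Import monalg.
From Stdlib Require Import Eqdep_dec.

(** Substitution of a polynomial s into a star-word u is the linear extension of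
    the substitution of words (psubstE), and by the monotonicity of the order it
    carries the leading word of s to that of u|_s (leading_psubst).  The ideal
    generated by S is therefore the span of the polynomials u|_s with s in S,
    filtered by the leading words of these generators (span_below).

    From (I) to (II): write f in Id(S) as a combination of generators u|_s, and
    let w be the largest of their leading words.  Any two generators with the
    same leading word w differ by a combination of generators with leading words
    below w (overlap_cancel).  Indeed two occurrences of subwords in a word are
    either nested, and then the difference is a substituted inclusion
    composition, which is trivial by hypothesis; or disjoint (wsubst_overlap),
    and then both generators come from one word with two holes, into which the
    two elements of S are substituted in either order: a commutation of sums
    makes the leading terms cancel.  So f is a multiple a u|_s of a single
    generator with leading word w, up to generators below w.  If a is nonzero,
    then w is the leading word of f; otherwise f lies in a smaller step of the
    filtration and well-founded induction on w concludes (leading_reducible).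

    From (II) to (III): a combination of irreducible words that lies in Id(S)
    has an irreducible leading word unless it vanishes, so the irreducible words
    are independent modulo Id(S).  They span for every monic S: a reducible word
    is rewritten into smaller words, by well-founded induction (reduces_word).

    From (III) to (I): a composition h with respect to w involves only words
    below w, and the same reduction writes it as a combination of generators
    below w plus a combination of irreducible words.  The latter lies in Id(S)
    together with h, so it vanishes by independence, and h is trivial. *)

Set Implicit Arguments.
Unset Strict Implicit.
Unset Printing Implicit Defensive.

Import GRing.Theory.

Local Open Scope ring_scope.

(** * Words, contexts and star-words *)

Section Words.
Variable Omega : nat -> Type.

(** The induction principle generated for words gives no hypothesis for the
    arguments of an operation, since these are the values of a finite
    function. *)
Lemma word_induction Y (P : word Omega Y -> Prop) :
  (forall y, P (Var y)) ->
  (forall n (d : Omega n.+1) (u : {ffun 'I_n.+1 -> word Omega Y}),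
    (forall i, P (u i)) -> P (Op d u)) ->
  forall w, P w.
Proof.
move=> PV PO; exact: (fix IH w := match w with
  | Var y => PV y | Op n d u => PO n d u (fun i => IH (u i)) end).
Qed.

Lemma Op_inj Y n (d d' : Omega n.+1) (u v : {ffun 'I_n.+1 -> word Omega Y}) :
  Op d u = Op d' v -> d = d' /\ u = v.
Proof.
move=> e; injection e => eu ed.
have inj := inj_pair2_eq_dec nat (@eq_comparable nat).
split; first exact: (inj (fun n => Omega n.+1) _ _ _ ed).
exact: (inj (fun n => {ffun 'I_n.+1 -> word Omega Y}) _ _ _ eu).
Qed.

Definition word_subst Y Z (f : Y -> word Omega Z) :
    word Omega Y -> word Omega Z :=
  interp (fun n d a => Op d (finfun a)) f.

Lemma interp_subst Y Z A (op : forall n, Omega n.+1 -> ('I_n.+1 -> A) -> A)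
    (v : Z -> A) (f : Y -> word Omega Z) w :
  interp op v (word_subst f w) = interp op (fun y => interp op v (f y)) w.
Proof.
elim/word_induction: w => //= n d u IH; congr (op n d _).
by apply: funext => i; rewrite ffunE IH.
Qed.

Lemma word_subst_Var Y (w : word Omega Y) : word_subst Var w = w.
Proof.
elim/word_induction: w => //= n d u IH; congr Op.
by apply/ffunP => i; rewrite ffunE -[RHS]IH.
Qed.

Variable X : Type.
Local Notation W := (word Omega X).

(** A context is a word with one hole in which the path from the root to the
    hole is explicit, so that proofs can follow it.  The siblings of the hole are
    indexed by ['I_n], through [lift i]: a family over ['I_n.+1] would also need
    a word at position [i], and there is none when [X] is empty. *)
Inductive ctx : Type :=
| Hole
| Node n of Omega n.+1 & 'I_n.+1 & 'I_n -> W & ctx.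

Fixpoint fill (c : ctx) (v : W) : W :=
  match c with
  | Hole => v
  | Node n d i sib c' => Op d [ffun j => oapp sib (fill c' v) (unlift i j)]
  end.

Definition ground : W -> word Omega (option X) :=
  word_subst (fun x => Var (Some x)).

Fixpoint ctx_word (c : ctx) : word Omega (option X) :=
  match c with
  | Hole => Var None
  | Node n d i sib c' =>
      Op d [ffun j => oapp (fun k => ground (sib k)) (ctx_word c') (unlift i j)]
  end.

Lemma star_count_ground w : star_count (ground w) = 0%N.
Proof.
rewrite /star_count interp_subst /=; elim/word_induction: w => //= n d u IH.
by rewrite big1.
Qed.

Lemma star_count_ctx c : star_count (ctx_word c) = 1%N.
Proof.
elim: c => //= n d i sib c IH; rewrite /star_count /= (bigD1_ord i) //=.
rewrite ffunE unlift_none /= -/(star_count _) IH big1 // => j _.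
by rewrite ffunE liftK /= -/(star_count _) star_count_ground.
Qed.

Definition star_of_ctx c : star_word Omega X :=
  exist _ (ctx_word c) (star_count_ctx c).

Lemma groundP u : star_count u = 0%N -> exists w, u = ground w.
Proof.
elim/word_induction: u => [[x|]|n d u IH] //; first by exists (Var x).
move/eqP; rewrite /star_count /= sum_nat_eq0 => /forallP u0.
have /fin_all_exists[w uw] : forall i, exists w, u i = ground w.
  by move=> i; apply: IH; apply/eqP/u0.
exists (Op d (finfun w)); congr Op; apply/ffunP => i.
by rewrite !ffunE uw.
Qed.

Lemma ctx_wordP u : star_count u = 1%N -> exists c, u = ctx_word c.
Proof.
elim/word_induction: u => [[x|]|n d u IH] //; first by exists Hole.
rewrite /star_count /= => /eqP/sum_nat_eq1[/= i [_ ui u0]].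
have [c uc] := IH i ui.
have /fin_all_exists[sib usib] : forall k, exists w, u (lift i k) = ground w.
  by move=> k; apply: groundP; apply: u0; rewrite // eq_sym neq_lift.
exists (Node d i sib c); congr Op; apply/ffunP => j; rewrite ffunE.
by case: unliftP => [k|] ->.
Qed.

Lemma wsubst_ctx c v : wsubst (star_of_ctx c) v = fill c v.
Proof.
rewrite /wsubst; elim: c => //= n d i sib c IH; congr Op.
apply/ffunP => j; rewrite !ffunE; case: unlift => //= k.
rewrite /ground interp_subst /= -[RHS]word_subst_Var.
by congr interp.
Qed.

(** Contexts and star-words are the same thing, so structural recursion on
    contexts is available for star-words. *)
Lemma star_ctxP (u : star_word Omega X) : exists c, u = star_of_ctx c.
Proof.
case: u => u u1; have [c uc] := ctx_wordP u1; exists c.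
by subst u; congr exist; apply: eq_irrelevance.
Qed.

Fixpoint ctx_comp (c c' : ctx) : ctx :=
  match c with
  | Hole => c'
  | Node n d i sib c1 => Node d i sib (ctx_comp c1 c')
  end.

Lemma fill_comp c c' v : fill (ctx_comp c c') v = fill c (fill c' v).
Proof. by elim: c => //= n d i sib c ->. Qed.

(** Two occurrences [a] and [b] of subwords of one word are nested or disjoint:
    the paths to the two holes are compared from the root until one of them ends
    or they diverge.  In the disjoint case, [p] and [q] are the two ways to see
    a word with two holes as a one-hole context depending on the word in the
    other hole. *)
Lemma fill_overlap c1 c2 a b : fill c1 a = fill c2 b ->
  [\/ exists2 c, a = fill c b & forall x, fill c2 x = fill c1 (fill c x),
      exists2 c, b = fill c a & forall x, fill c1 x = fill c2 (fill c x)
    | exists p q, [/\ fill (p b) =1 fill c1, fill (q a) =1 fill c2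
                    & forall x y, fill (p y) x = fill (q x) y]].
Proof.
elim: c1 c2 => [|n d i sib c1 IH] [|n' d' i' sib' c2] /=.
- by move=> ->; constructor 1; exists Hole.
- by move=> ->; constructor 1; exists (Node d' i' sib' c2).
- by move=> <-; constructor 2; exists (Node d i sib c1).
move=> e; have [en _ _] := e; subst n'.
have [ed] := Op_inj e; subst d' => /ffunP{}e.
have {}e j := etrans (esym (ffunE _ j)) (etrans (e j) (ffunE _ j)).
have [ii|nii] := eqVneq i' i.
  subst i'; have sibE k : sib' k = sib k by have := e (lift i k); rewrite liftK.
  have := e i; rewrite unlift_none /= => /IH [] [].
  - move=> c -> cE; constructor 1; exists c => // x; congr Op.
    by apply/ffunP => j; rewrite !ffunE cE; case: unlift => /=.
  - move=> c -> cE; constructor 2; exists c => // x; congr Op.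
    by apply/ffunP => j; rewrite !ffunE cE; case: unlift => /=.
  - move=> p [q [pE qE pq]]; constructor 3.
    exists (fun y => Node d i sib (p y)), (fun x => Node d i sib' (q x)).
    split=> [x|x|x y] /=; congr Op; apply/ffunP => j; rewrite !ffunE;
      by case: unlift => //=.
(* The paths diverge here: the hole of each context lies in one of the siblings
   along the path of the other. *)
constructor 3.
exists (fun y =>
  Node d i (fun k => if lift i k == i' then fill c2 y else sib k) c1).
exists (fun x =>
  Node d i' (fun k => if lift i' k == i then fill c1 x else sib' k) c2).
split=> [x|x|x y] /=; congr Op; apply/ffunP => j; rewrite !ffunE.
- case: unliftP => //= k jk; case: eqP => // ki'.
  by have := e i'; rewrite unlift_none /= -{1}ki' liftK /=.
- case: unliftP => //= k jk; case: eqP => // ki'.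
  by have := e i; rewrite unlift_none /= -{1}ki' liftK /=.
- have := e j; case: (unliftP i j) => [k jk|ji];
    case: (unliftP i' j) => [k' jk'|ji'] /=.
  + by rewrite -jk -jk' {2}jk jk'
       ![lift _ _ == _]eq_sym !(negbTE (neq_lift _ _)).
  + by rewrite -jk ji' eqxx.
  + by rewrite -jk' ji eqxx.
  + by rewrite -ji ji' eqxx in nii.
Qed.
End Words.

(** * Substitution of polynomials into star-words *)

Section Substitution.
Variables (k : fieldType) (Omega : nat -> Type) (X : Type).
Local Notation P := (opoly k Omega X).
Implicit Types (f g s : P) (u : star_word Omega X).

(** This formula, together with the vanishing of all other coefficients, reduces
    statements on the multilinear extension to statements on products; the
    supports over which [opoly_op] sums no longer appear. *)
Lemma mcoeff_opoly_op n (d : Omega n.+1) (F : 'I_n.+1 -> P)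
    (v : {ffun 'I_n.+1 -> word Omega X}) :
  (opoly_op d F)@_(Op d v) = \prod_i (F i)@_(v i).
Proof.
rewrite /opoly_op raddf_sum /=.
have [Fv|] := boolP [forall i, v i \in msupp (F i)]; last first.
  rewrite negb_forall => /existsP[i vi].
  rewrite [RHS](bigD1 i) //= (mcoeff_outdom vi) mul0r big1 // => w _.
  rewrite mcoeffU; case: eqP => // wv; have [_ e] := Op_inj wv; case/negP: vi.
  by rewrite -e ffunE; apply: valP.
move/forallP: Fv => Fv.
pose w0 : {dffun forall i : 'I_n.+1, msupp (F i)} :=
  [ffun i => FSetSub (Fv i) : msupp (F i)].
rewrite (bigD1 w0) //= [X in _ + X]big1 ?addr0 => [|w ww0].
  rewrite mcoeffU.
  have -> : [ffun i => val (w0 i)] = v by apply/ffunP => i; rewrite !ffunE.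
  by rewrite eqxx mulr1n; apply: eq_bigr => i _; rewrite ffunE.
rewrite mcoeffU; case: eqP => // wv; have [_ e] := Op_inj wv; case/eqP: ww0.
apply/ffunP => i; apply: val_inj; rewrite ffunE /=.
by have /ffunP/(_ i) := e; rewrite ffunE.
Qed.

Lemma mcoeff_opoly_op_out n (d : Omega n.+1) (F : 'I_n.+1 -> P) x :
  (forall v, x <> Op d v) -> (opoly_op d F)@_x = 0.
Proof.
move=> xd; rewrite /opoly_op raddf_sum /= big1 // => w _.
by rewrite mcoeffU; case: eqP => // /esym /xd.
Qed.

Lemma opoly_opU n (d : Omega n.+1) (v : 'I_n.+1 -> word Omega X) :
  opoly_op d (fun i => << v i >> : P) = << Op d (finfun v) >>.
Proof.
apply/malgP => x; have [[w ->]|nx] := pselect (exists w, x = Op d w).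
  rewrite mcoeff_opoly_op mcoeffU; case: eqP => [vw|nw].
    have [_ <-] := Op_inj vw.
    by rewrite big1 // => i _; rewrite mcoeffU ffunE eqxx.
  have [vw|] := boolP [forall i, v i == w i].
    case: nw; congr Op; apply/ffunP => i; rewrite ffunE.
    exact/eqP/(forallP vw).
  rewrite negb_forall => /existsP[i /negbTE vi].
  by rewrite (bigD1 i) //= mcoeffU vi mul0r.
rewrite mcoeff_opoly_op_out => [|w xw]; last by apply: nx; exists w.
by rewrite mcoeffU; case: eqP => // e; case: nx; exists (finfun v).
Qed.

Definition eval_opoly s : word Omega (option X) -> P :=
  interp (@opoly_op k Omega X)
         (fun y => if y is Some x then << Var x >> else s).

Lemma eval_ground s w : eval_opoly s (ground w) = << w >>.
Proof.
rewrite /eval_opoly interp_subst /=; elim/word_induction: w => //= n d v IH.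
under eq_fun do rewrite IH.
by rewrite opoly_opU; congr << Op _ _ >>; apply/ffunP => i; rewrite ffunE.
Qed.

(** The star occurs once, so by multilinearity the unique factor that contains
    it carries the linearity, while the siblings of the path to the star are
    ground words, unaffected by the substitution. *)
Lemma psubst_linear u (a : k) f g :
  psubst u (a *: f + g) = a *: psubst u f + psubst u g.
Proof.
have [c ->] := star_ctxP u; rewrite /psubst /=.
elim: c => //= n d i sib c IH.
apply/malgP => x; rewrite mcoeffD mcoeffZ.
have [[w ->]|nx] := pselect (exists w, x = Op d w); last first.
  have xd w : x <> Op d w by move=> xw; apply: nx; exists w.
  by rewrite !mcoeff_opoly_op_out // mulr0 addr0.
rewrite !mcoeff_opoly_op !(bigD1_ord i) //= !ffunE unlift_none /= IH.
rewrite mcoeffD mcoeffZ mulrDl mulrA; congr (_ * _ + _ * _).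
  apply: eq_bigr => j _; rewrite !ffunE liftK /=.
  by rewrite -!/(eval_opoly _ _) !eval_ground.
apply: eq_bigr => j _; rewrite !ffunE liftK /=.
by rewrite -!/(eval_opoly _ _) !eval_ground.
Qed.

HB.instance Definition _ u :=
  GRing.isLinear.Build k P P *:%R (psubst u)
    (fun a f g => psubst_linear u a f g).

Lemma psubstU u v : psubst u << v >> = << wsubst u v >> :> P.
Proof.
rewrite /psubst /wsubst; elim/word_induction: (sval u) => [[x|]|n d w IH] //=.
by under [in LHS]eq_fun do rewrite IH; rewrite opoly_opU.
Qed.

Lemma psubstE u f :
  psubst u f = \sum_(v <- msupp f) f@_v *: << wsubst u v >>.
Proof.
rewrite {1}[f]monalgE raddf_sum /=; apply: eq_bigr => v _.
have -> : << f@_v *g v >> = f@_v *: << v >> :> P.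
  by apply/malgP => x; rewrite mcoeffZ !mcoeffU mulr_natr.
by rewrite linearZ /= psubstU.
Qed.
End Substitution.

Section StarWords.
Variables (k : fieldType) (Omega : nat -> Type) (X : Type).
Local Notation P := (opoly k Omega X).
Implicit Types (f g s : P) (u : star_word Omega X).

Lemma eq_psubst u u' f : wsubst u =1 wsubst u' -> psubst u f = psubst u' f.
Proof. by move=> e; rewrite !psubstE; apply: eq_bigr => v _; rewrite e. Qed.

Lemma star_word_id : exists u : star_word Omega X, forall f, psubst u f = f.
Proof. by exists (star_of_ctx (Hole Omega X)). Qed.

Lemma star_word_comp u u' : exists u2 : star_word Omega X,
  (forall v, wsubst u2 v = wsubst u (wsubst u' v)) /\
  forall f, psubst u2 f = psubst u (psubst u' f).
Proof.
have [c uE] := star_ctxP u; have [c' u'E] := star_ctxP u'.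
exists (star_of_ctx (ctx_comp c c')).
have wE v : wsubst (star_of_ctx (ctx_comp c c')) v = wsubst u (wsubst u' v).
  by rewrite uE u'E !wsubst_ctx fill_comp.
split=> // f; rewrite [psubst u' f]psubstE raddf_sum /= psubstE.
by apply: eq_bigr => v _; rewrite linearZ /= psubstU wE.
Qed.

Lemma wsubst_overlap u1 u2 a b : wsubst u1 a = wsubst u2 b ->
  [\/ exists2 u, a = wsubst u b &
        forall x, wsubst u2 x = wsubst u1 (wsubst u x),
      exists2 u, b = wsubst u a &
        forall x, wsubst u1 x = wsubst u2 (wsubst u x)
    | exists p q : word Omega X -> star_word Omega X,
      [/\ wsubst (p b) =1 wsubst u1, wsubst (q a) =1 wsubst u2
        & forall x y, wsubst (p y) x = wsubst (q x) y]].
Proof.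
have [c1 ->] := star_ctxP u1; have [c2 ->] := star_ctxP u2.
rewrite !wsubst_ctx => /fill_overlap[] [].
- move=> c -> cE; constructor 1; exists (star_of_ctx c); rewrite ?wsubst_ctx //.
  by move=> x; rewrite !wsubst_ctx.
- move=> c -> cE; constructor 2; exists (star_of_ctx c); rewrite ?wsubst_ctx //.
  by move=> x; rewrite !wsubst_ctx.
- move=> p [q [pE qE pq]]; constructor 3.
  exists (fun y => star_of_ctx (p y)), (fun x => star_of_ctx (q x)).
  by split=> [x|x|x y]; rewrite !wsubst_ctx.
Qed.

Lemma mkmalgUZ (a : k) v : << a *g v >> = a *: << v >> :> P.
Proof. by apply/malgP => x; rewrite mcoeffZ !mcoeffU mulr_natr. Qed.

(** Substituting [f] and [g] into the two holes of a word gives the same result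
    in either order; both sides are the double sum over the two supports. *)
Lemma psubst_swap (p q : word Omega X -> star_word Omega X) f g :
  (forall x y, wsubst (p y) x = wsubst (q x) y) ->
  \sum_(y <- msupp g) g@_y *: psubst (p y) f
    = \sum_(x <- msupp f) f@_x *: psubst (q x) g.
Proof.
move=> pq; under eq_bigr do rewrite psubstE scaler_sumr.
rewrite exchange_big /=; apply: eq_bigr => x _.
rewrite psubstE scaler_sumr; apply: eq_bigr => y _.
by rewrite !scalerA pq mulrC.
Qed.
End StarWords.

(** * Leading words and the filtration of the ideal *)

Section Leading.
Variables (k : fieldType) (Omega : nat -> Type) (X : Type).
Variable lt : word Omega X -> word Omega X -> Prop.
Hypothesis hlt : monomial_order lt.
Local Notation P := (opoly k Omega X).
Implicit Types (f g s : P) (u : star_word Omega X) (S : set P).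
Local Notation le v w := (v = w \/ lt v w).

Lemma lt_irrefl v : ~ lt v v.
Proof. by elim/(well_founded_ind (mo_wf hlt)): v => v IH vv; apply: (IH v). Qed.

Lemma le_lt_trans v w x : le v w -> lt w x -> lt v x.
Proof. by case=> [->|/(mo_trans hlt)] //; apply. Qed.

Lemma le_total v w : le v w \/ lt w v.
Proof.
have [->|/eqP/(mo_total hlt)[]] := eqVneq v w;
  by [left; left | left; right | right].
Qed.

(** Distinct words are comparable, and monotonicity keeps them apart. *)
Lemma wsubst_inj u : injective (wsubst u).
Proof.
move=> v w e; apply/eqP; apply: contrapT => /negP/eqP/(mo_total hlt).
by case=> /(mo_subst hlt u); rewrite e => /lt_irrefl.
Qed.

(** The weak form, with coefficients instead of supports, behaves well under
    sums and scalings. *)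
Lemma leadingP f w : leading lt f w <->
  f@_w <> 0 /\ forall v, f@_v <> 0 -> le v w.
Proof.
split=> -[fw ltw]; split.
- by apply/eqP; rewrite mcoeff_neq0.
- move=> v /eqP; rewrite mcoeff_neq0 => vf.
  by have [->|/eqP vw] := eqVneq v w; [left | right; apply: ltw].
- by rewrite -mcoeff_neq0; apply/eqP.
- by move=> v; rewrite -mcoeff_neq0 => /eqP /ltw[].
Qed.

Lemma leading_uniq f w w' : leading lt f w -> leading lt f w' -> w = w'.
Proof.
move=> /leadingP[fw ltw] /leadingP[fw' ltw'].
case: (ltw _ fw') => // w'w; case: (ltw' _ fw) => // ww'.
by case: (@lt_irrefl w); apply: mo_trans ww' w'w.
Qed.

Lemma mcoeff_psubst u s v : (psubst u s)@_(wsubst u v) = s@_v.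
Proof.
rewrite psubstE raddf_sum /=.
under eq_bigr do rewrite mcoeffZ mcoeffU (inj_eq (@wsubst_inj u)).
have [vs|vs] := boolP (v \in msupp s); last first.
  rewrite (mcoeff_outdom vs) big_seq big1 // => x xs.
  by case: eqP => [xv|]; rewrite ?mulr0 // -xv xs in vs *.
rewrite (big_fsetD1 v) //= eqxx mulr1 big_seq big1 ?addr0 // => x.
by rewrite !inE => /andP[/negbTE->]; rewrite mulr0.
Qed.

Lemma mcoeff_psubst_neq0 u s w :
  (psubst u s)@_w <> 0 -> exists2 v, w = wsubst u v & s@_v <> 0.
Proof.
move=> sw; apply: contrapT => nv; apply: sw.
rewrite psubstE raddf_sum /= big_seq big1 // => v vs.
rewrite mcoeffZ mcoeffU; case: eqP => [wv|]; last by rewrite mulr0.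
by case: nv; exists v => //; apply/eqP; rewrite mcoeff_neq0.
Qed.

Lemma leading_psubst u s sbar : leading lt s sbar ->
  leading lt (psubst u s) (wsubst u sbar).
Proof.
move=> /leadingP[s0 smax]; apply/leadingP.
split=> [|w]; first by rewrite mcoeff_psubst.
move=> /mcoeff_psubst_neq0[v -> /smax[->|vs]]; first by left.
by right; apply: mo_subst.
Qed.

(** One filtered span for the two notions of the theorem: when S is monic it is
    Id(S) for [Q] true everywhere, and for [Q] the words below [w] it consists
    of the polynomials that are trivial modulo (S, w).  The inductive form
    replaces the finite families of coefficients and star-words by induction. *)
Inductive span_below S (Q : word Omega X -> Prop) : P -> Prop :=
| span_below0 : span_below S Q 0
| span_belowD a u s sbar f : S s -> leading lt s sbar -> Q (wsubst u sbar) ->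
    span_below S Q f -> span_below S Q (a *: psubst u s + f).

Variable S : set P.
Implicit Types Q : word Omega X -> Prop.

Lemma span_below_mono Q Q' f : (forall w, Q w -> Q' w) ->
  span_below S Q f -> span_below S Q' f.
Proof.
move=> QQ'; elim=> [|a u s sbar {}f Ss sb /QQ' Qs _ IH]; first by left.
by apply: span_belowD IH; eassumption.
Qed.

Lemma span_below_add Q f g :
  span_below S Q f -> span_below S Q g -> span_below S Q (f + g).
Proof.
move=> + Sg; elim=> [|a u s sbar {}f Ss sb Qs _ IH]; first by rewrite add0r.
by rewrite -addrA; apply: span_belowD IH; eassumption.
Qed.

Lemma span_below_scale Q a f : span_below S Q f -> span_below S Q (a *: f).
Proof.
elim=> [|b u s sbar {}f Ss sb Qs _ IH]; first by rewrite scaler0; left.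
by rewrite scalerDr scalerA; apply: span_belowD IH; eassumption.
Qed.

Lemma span_below_psubst Q u s sbar : S s -> leading lt s sbar ->
  Q (wsubst u sbar) -> span_below S Q (psubst u s).
Proof.
move=> Ss sb Qs; rewrite -[psubst u s]addr0 -[psubst u s]scale1r.
by apply: span_belowD (span_below0 _ _); eassumption.
Qed.

Lemma span_below_opp Q f : span_below S Q f -> span_below S Q (- f).
Proof. by rewrite -scaleN1r; apply: span_below_scale. Qed.

Lemma span_below_sum Q (I : eqType) (r : seq I) (F : I -> P) :
  (forall i, i \in r -> span_below S Q (F i)) ->
  span_below S Q (\sum_(i <- r) F i).
Proof.
rewrite big_seq => SF.
by elim/big_ind: _ => //; [left | apply: span_below_add].
Qed.

(** A star-word plugged into a star-word is a star-word, so substitution maps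
    generators to generators. *)
Lemma span_below_psubst_star Q Q' u f : (forall v, Q v -> Q' (wsubst u v)) ->
  span_below S Q f -> span_below S Q' (psubst u f).
Proof.
move=> QQ'; elim=> [|a u' s sbar {}f Ss sb Qs _ IH].
  by rewrite linear0; left.
rewrite psubst_linear; have [u2 [u2E <-]] := star_word_comp k u u'.
by apply: span_belowD sb _ IH => //; rewrite u2E; apply: QQ'.
Qed.

Lemma trivial_modE w h : trivial_mod lt S w h <-> span_below S (lt^~ w) h.
Proof.
split=> [[m [a [u [s [us ->]]]]]|].
  apply: span_below_sum => i _; apply: span_below_scale.
  by have [Ss [sbar [sb lts]]] := us i; apply: span_below_psubst sb _.
elim=> [|a u s sbar f Ss sb ltw _ [m [a' [u' [s' [us' ->]]]]]].
  exists 0%N, (fun=> 0).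
  have [u0 _] := star_word_id k Omega X.
  exists (fun=> u0), (fun=> 0); rewrite big_ord0; split=> // -[] //.
exists m.+1, (fun i => oapp a' a (unlift ord0 i)).
exists (fun i => oapp u' u (unlift ord0 i)).
exists (fun i => oapp s' s (unlift ord0 i)).
split=> [i|].
  by case: unliftP => [j|] _ /=; [apply: us' | split=> //; exists sbar].
rewrite big_ord_recl unlift_none /=; congr (_ + _); apply: eq_bigr => i _.
by rewrite liftK.
Qed.

Lemma span_below_coef Q f w : span_below S Q f -> f@_w <> 0 ->
  exists2 v, Q v & le w v.
Proof.
elim=> [|a u s sbar {}f Ss sb Qs _ IH]; first by rewrite mcoeff0.
rewrite mcoeffD mcoeffZ => fw.
have [fw0|/eqP /IH //] := eqVneq f@_w 0.
exists (wsubst u sbar) => //.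
have /leadingP[_] := leading_psubst u sb; apply=> s0; apply: fw.
by rewrite fw0 s0 mulr0 addr0.
Qed.

(** A sum is finite, so an element of the span is controlled by a largest
    leading word; this is what makes well-founded induction applicable. *)
Lemma span_below_le Q f : span_below S Q f ->
  f = 0 \/ exists2 w, Q w & span_below S (fun v => le v w) f.
Proof.
elim=> [|a u s sbar {}f Ss sb Qs _ IH]; first by left.
right; case: IH => [->|[w Qw Sf]].
  exists (wsubst u sbar) => //.
  by apply: span_belowD sb _ (span_below0 _ _) => //; left.
have [sw|ws] := le_total (wsubst u sbar) w.
  by exists w => //; apply: span_belowD Sf; eassumption.
exists (wsubst u sbar) => //; apply: span_belowD sb _ _ => //; first by left.
by apply: span_below_mono Sf => v vw; right; apply: le_lt_trans ws.
Qed.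

Hypothesis hS : forall s, S s -> omonic lt s.

Lemma monic_leading s sbar : S s -> leading lt s sbar -> s@_sbar = 1.
Proof. by move=> /hS[w [sw s1]] /leading_uniq/(_ sw) ->. Qed.

Lemma span_below_ideal Q f : span_below S Q f -> ideal_gen S f.
Proof.
move=> Sf I idI SI; case: (idI) => I0 Ilin Isub.
by elim: Sf => // a u s sbar {}f Ss _ _ _ If; apply: Ilin => //; apply/Isub/SI.
Qed.

(** The span contains S and is stable under substitution into star-words, so it
    is an ideal that contains S. *)
Lemma ideal_gen_span f : ideal_gen S f -> span_below S (fun=> True) f.
Proof.
apply=> [|s Ss]; last first.
  have [u uE] := star_word_id k Omega X; rewrite -[s]uE.
  by have [sbar [sb _]] := hS Ss; apply: span_below_psubst sb _.
split; first by left.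
  by move=> a g h Sg Sh; apply/span_below_add/Sh/span_below_scale.
by move=> g u; apply: span_below_psubst_star.
Qed.

Lemma psubst_tail u s w : S s -> leading lt s w ->
  psubst u s = << wsubst u w >>
    + \sum_(v <- (msupp s `\ w)%fset) s@_v *: << wsubst u v >>.
Proof.
move=> Ss sw; rewrite psubstE (big_fsetD1 w) /=; last by case: sw.
by rewrite (monic_leading Ss sw) scale1r.
Qed.

Lemma tail_lt s w v : leading lt s w -> v \in (msupp s `\ w)%fset -> lt v w.
Proof. by case=> _ ltw; rewrite !inE => /andP[/eqP vw vs]; apply: ltw. Qed.
End Leading.

(** * Linear combinations of a family *)

Section LinearCombinations.
Variables (k : fieldType) (J : choiceType).

Section Linearity.
Variables (V : lmodType k) (b : J -> V).

Lemma lincomb_widen (c : {malg k[J]}) (D : {fset J}) : (msupp c `<=` D)%fset ->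
  lincomb b c = \sum_(j <- D) c@_j *: b j.
Proof.
move=> cD; apply: big_fset_incl => // j _ jc.
by rewrite (mcoeff_outdom jc) scale0r.
Qed.

Lemma lincomb_is_linear : linear (lincomb b).
Proof.
move=> a c c'; pose D := (msupp c `|` msupp c' `|` msupp (a *: c + c'))%fset.
have Dsub : [/\ (msupp c `<=` D)%fset, (msupp c' `<=` D)%fset
              & (msupp (a *: c + c') `<=` D)%fset].
  by split; apply/fsubsetP => j; rewrite !inE => ->; rewrite ?orbT.
case: Dsub => /lincomb_widen-> /lincomb_widen-> /lincomb_widen->.
rewrite scaler_sumr -big_split; apply: eq_bigr => j _ /=.
by rewrite mcoeffD mcoeffZ scalerDl scalerA.
Qed.

HB.instance Definition _ :=
  GRing.isLinear.Build k {malg k[J]} V *:%R (lincomb b) lincomb_is_linear.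

Lemma lincombU j : lincomb b << j >> = b j.
Proof.
rewrite (@lincomb_widen _ [fset j]%fset) ?msuppU_le //.
by rewrite big_seq_fset1 mcoeffUU scale1r.
Qed.
End Linearity.

Lemma linear_lincomb (V V' : lmodType k) (F : {linear V -> V'}) (b : J -> V) c :
  F (lincomb b c) = lincomb (F \o b) c.
Proof.
by rewrite /lincomb linear_sum; apply: eq_bigr => j _; rewrite linearZ.
Qed.

Lemma mcoeff_lincombU (K : choiceType) (e : J -> K) (c : {malg k[J]}) j :
  injective e -> (lincomb (fun i => << e i >> : {malg k[K]}) c)@_(e j) = c@_j.
Proof.
move=> einj; rewrite (@lincomb_widen _ _ _ (j |` msupp c)%fset) ?fsubsetU1 //.
rewrite raddf_sum (big_fsetD1 j) ?fset1U1 //= mcoeffZ mcoeffU eqxx mulr1.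
rewrite big_seq big1 ?addr0 // => i; rewrite !inE => /andP[/negbTE ij _].
by rewrite mcoeffZ mcoeffU (inj_eq einj) ij mulr0.
Qed.

Lemma mcoeff_lincombU_neq0 (K : choiceType) (e : J -> K) (c : {malg k[J]}) v :
  (lincomb (fun i => << e i >> : {malg k[K]}) c)@_v <> 0 -> exists j, v = e j.
Proof.
move=> cv; apply: contrapT => nv; apply: cv.
rewrite raddf_sum big1 // => j _ /=; rewrite mcoeffZ mcoeffU.
by case: eqP => [ev|]; rewrite ?mulr0 //; case: nv; exists j.
Qed.
End LinearCombinations.

(** * The three implications *)

Section Diamond.
Variables (k : fieldType) (Omega : nat -> Type) (X : Type).
Variable lt : word Omega X -> word Omega X -> Prop.
Hypothesis hlt : monomial_order lt.
Local Notation P := (opoly k Omega X).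
Implicit Types (f g s : P) (u : star_word Omega X).
Local Notation le v w := (v = w \/ lt v w).
Variable S : set P.
Hypothesis hS : forall s, S s -> omonic lt s.
Implicit Types Q : word Omega X -> Prop.

Fact opoly_class_linear : linear (opoly_class S).
Proof. by move=> a f g; rewrite opoly_classD -quot_scale_class. Qed.

HB.instance Definition _ := GRing.isLinear.Build k P (opoly_quot S) *:%R
  (opoly_class S) opoly_class_linear.

Lemma opoly_class_eq0 f : opoly_class S f = 0 <-> ideal_gen S f.
Proof.
rewrite -(linear0 (opoly_class S)); split.
  by move/opoly_classP/asboolP; rewrite subr0.
by move=> Sf; apply/opoly_classP/asboolP; rewrite subr0.
Qed.

Section Confluence.
Hypothesis gsS : groebner_shirshov lt S.

(** The nested case: the difference is the composition of [s1] and [s2] with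
    respect to [a], substituted into [u1]. *)
Lemma inclusion_cancel u1 u2 u s1 s2 a b :
    S s1 -> S s2 -> leading lt s1 a -> leading lt s2 b ->
    a = wsubst u b -> (forall x, wsubst u2 x = wsubst u1 (wsubst u x)) ->
  span_below lt S (lt^~ (wsubst u1 a)) (psubst u1 s1 - psubst u2 s2).
Proof.
move=> Ss1 Ss2 s1a s2b ab u2E.
have [u3 [u3E u3P]] := star_word_comp k u1 u.
have -> : psubst u2 s2 = psubst u1 (psubst u s2).
  by rewrite -u3P; apply: eq_psubst => x; rewrite u3E u2E.
rewrite -linearB; apply: (@span_below_psubst_star _ _ _ _ _ (lt^~ a)).
  by move=> v; apply: mo_subst.
by apply/trivial_modE/(gsS Ss1 Ss2); exists u, b.
Qed.

(** The heart of the theorem: modulo generators below a word [w], all generators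
    with leading word [w] agree. *)
Lemma overlap_cancel u1 u2 s1 s2 a b :
    S s1 -> S s2 -> leading lt s1 a -> leading lt s2 b ->
    wsubst u1 a = wsubst u2 b ->
  span_below lt S (lt^~ (wsubst u1 a)) (psubst u1 s1 - psubst u2 s2).
Proof.
move=> Ss1 Ss2 s1a s2b ab.
case: (wsubst_overlap ab) => [[u au u2E]|[u bu u1E]|[p [q [pE qE pq]]]].
- exact: inclusion_cancel s1a s2b au u2E.
- rewrite ab -opprB; apply: span_below_opp.
  exact: inclusion_cancel s2b s1a bu u1E.
(* S is monic, so the term of index b on the left is psubst u1 s1 and the term
   of index a on the right is psubst u2 s2; all others are multiples of
   generators with leading word below w. *)
have := psubst_swap s1 s2 pq.
have [as1 _] := s1a; have [bs2 _] := s2b.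
rewrite (big_fsetD1 b) //= [RHS](big_fsetD1 a) //=.
rewrite (monic_leading hlt hS Ss1 s1a) (monic_leading hlt hS Ss2 s2b) !scale1r.
rewrite (eq_psubst _ pE) (eq_psubst _ qE).
set A := \sum_(y <- _) _; set B := \sum_(x <- _) _ => E.
have -> : psubst u1 s1 - psubst u2 s2 = B - A.
  by rewrite -[psubst u1 s1](addrK A) E addrAC [X in X - _ - _]addrC addrK.
apply: span_below_add.
  apply: span_below_sum => x /(tail_lt s1a) xa; apply: span_below_scale.
  apply: span_below_psubst s2b _ => //.
  by rewrite -pq pE; apply: mo_subst.
apply/span_below_opp/span_below_sum => y /(tail_lt s2b) yb.
apply: span_below_scale; apply: span_below_psubst s1a _ => //.
by rewrite pq qE ab; apply: mo_subst.
Qed.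

(** Generators with leading word [w] agree modulo the ones below, so they can be
    collected into a multiple of a single one. *)
Lemma span_below_split w f : span_below lt S (fun v => le v w) f ->
  exists2 g, span_below lt S (lt^~ w) g &
    f = g \/ exists a u s sbar, [/\ S s, leading lt s sbar, w = wsubst u sbar
                                 & f = a *: psubst u s + g].
Proof.
elim=> [|a u s sbar {}f Ss sb sw _ [g Sg fg]]; first by exists 0; [left|left].
case: sw => [sw|sw]; last first.
  exists (a *: psubst u s + g); first by apply: span_belowD sb _ _.
  case: fg => [->|[a' [u' [s' [sbar' [Ss' sb' wE ->]]]]]]; first by left.
  by right; exists a', u', s', sbar'; split=> //; rewrite addrCA.
case: fg => [->|[a' [u' [s' [sbar' [Ss' sb' wE ->]]]]]].
  by exists g => //; right; exists a, u, s, sbar.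
(* a u|_s + a' u'|_s' = a (u|_s - u'|_s') + (a + a') u'|_s', and the difference
   lies below w. *)
exists (a *: (psubst u s - psubst u' s') + g).
  apply: span_below_add => //; apply: span_below_scale; rewrite -sw.
  by apply: overlap_cancel sb sb' _ => //; rewrite sw.
right; exists (a + a'), u', s', sbar'; split=> //.
rewrite scalerBr scalerDl [RHS]addrACA; congr (_ + _).
by rewrite [RHS]addrC subrK.
Qed.

Lemma leading_reducible f : ideal_gen S f -> f <> 0 ->
  exists s u sbar, [/\ S s, leading lt s sbar & leading lt f (wsubst u sbar)].
Proof.
move=> /(ideal_gen_span hS)/(span_below_le hlt) [//|[w _]].
elim/(well_founded_ind (mo_wf hlt)): w f => w IH f.
move=> /span_below_split[g Sg fg] f0.
have smaller : span_below lt S (lt^~ w) f ->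
    exists s u sbar, [/\ S s, leading lt s sbar & leading lt f (wsubst u sbar)].
  by case/(span_below_le hlt) => // -[w' w'w Sf]; apply: IH Sf f0.
case: fg => [fg|[a [u [s [sbar [Ss sb wE fE]]]]]].
  by apply: smaller; rewrite fg.
have [a0|/eqP a0] := eqVneq a 0.
  by apply: smaller; rewrite fE a0 scale0r add0r.
have g_lt v : g@_v <> 0 -> lt v w.
  by move=> /(span_below_coef hlt Sg)[x xw /(le_lt_trans hlt)]; apply.
have gw : g@_w = 0.
  by apply: contrapT => /g_lt /(lt_irrefl hlt).
exists s, u, sbar; split=> //; rewrite -wE; apply/leadingP; split.
  rewrite fE mcoeffD mcoeffZ gw addr0 wE (mcoeff_psubst hlt).
  by rewrite (monic_leading hlt hS Ss sb) mulr1.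
move=> v; rewrite fE mcoeffD mcoeffZ => fv.
have [gv|/eqP /g_lt] := eqVneq g@_v 0; last by right.
have /leadingP[_] := leading_psubst hlt u sb; rewrite -wE; apply=> sv.
by apply: fv; rewrite sv gv mulr0 addr0.
Qed.
End Confluence.

Local Notation emb := (lincomb (fun w : irr lt S => << val w >> : P)).

Lemma class_emb c :
  lincomb (fun w : irr lt S => opoly_class S << val w >>) c
    = opoly_class S (emb c).
Proof. by rewrite linear_lincomb. Qed.

(** [f] has a normal form, i.e. a combination of irreducible words to which it
    reduces by generators with leading words in [Q]. *)
Definition reduces Q f := exists c, span_below lt S Q (f - emb c).

Lemma reduces_sum Q (r : seq (word Omega X)) (a : word Omega X -> k)
    (h : word Omega X -> word Omega X) :
  (forall v, v \in r -> reduces Q << h v >>) ->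
  reduces Q (\sum_(v <- r) a v *: << h v >>).
Proof.
rewrite big_seq => red; elim/big_ind: _ => [|f g [c Sf] [c' Sg]|v vr].
- by exists 0; rewrite linear0 subr0; left.
- exists (c + c'); rewrite linearD /= opprD addrACA.
  exact: span_below_add.
have [c Sc] := red v vr.
by exists (a v *: c); rewrite linearZ /= -scalerBr; apply: span_below_scale.
Qed.

Lemma reduces_poly Q f :
  (forall v, v \in msupp f -> reduces Q << v >>) -> reduces Q f.
Proof.
move=> red; rewrite [f]monalgE; under eq_bigr do rewrite mkmalgUZ.
exact: reduces_sum.
Qed.

(** A reducible word u|_sbar equals u|_s minus a combination of smaller words,
    whose normal forms are given by induction. *)
Lemma reduces_word w : reduces (fun v => le v w) << w >>.
Proof.
elim/(well_founded_ind (mo_wf hlt)): w => w IH.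
have [wI|] := pselect (irr lt S w).
  exists << exist _ w (mem_set wI) >>; rewrite lincombU subrr; left.
move=> /contrapT[s [u [sbar [Ss sb wE]]]].
have := psubst_tail hlt hS u Ss sb; rewrite -wE.
set T := \sum_(v <- _) _ => E.
have [c Sc] : reduces (fun v => le v w) (- T).
  rewrite /T -sumrN; under eq_bigr do rewrite -scaleNr.
  apply: reduces_sum => v /(tail_lt sb)/(mo_subst hlt u); rewrite -wE => vw.
  have [c Sc] := IH _ vw; exists c; apply: span_below_mono Sc => x xv.
  by right; apply: le_lt_trans vw.
exists c; have -> : << w >> - emb c = psubst u s + (- T - emb c).
  by rewrite E addrA addrK.
apply: span_below_add => //; apply: span_below_psubst sb _ => //.
by left.
Qed.

Lemma reduces_below w f : (forall v, f@_v <> 0 -> lt v w) ->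
  reduces (lt^~ w) f.
Proof.
move=> fw; apply: reduces_poly => v; rewrite -mcoeff_neq0 => /eqP/fw vw.
have [c Sc] := reduces_word v; exists c; apply: span_below_mono Sc => x xv.
exact: le_lt_trans hlt _ _ _ xv vw.
Qed.

(** The leading word of a combination of irreducible words is irreducible. *)
Lemma irr_independent c : ideal_gen S (emb c) ->
  (forall f, ideal_gen S f -> f <> 0 -> exists s u sbar,
     [/\ S s, leading lt s sbar & leading lt f (wsubst u sbar)]) -> c = 0.
Proof.
move=> Sc lead; apply/malgP => j; rewrite mcoeff0.
rewrite -(mcoeff_lincombU c j val_inj).
suff -> : emb c = 0 by rewrite mcoeff0.
apply: contrapT => /(lead _ Sc)[s [u [sbar [Ss sb [cw _]]]]].
have [|i wi] :=
    @mcoeff_lincombU_neq0 _ _ _ (val : irr lt S -> _) c (wsubst u sbar).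
  by apply/eqP; rewrite mcoeff_neq0.
by case: (set_valP i); exists s, u, sbar.
Qed.

End Diamond.

Theorem theorem2p4 (k : fieldType) (X : Type) (Omega : nat -> Type)
    (lt : word Omega X -> word Omega X -> Prop) (hlt : monomial_order lt)
    (S : set (opoly k Omega X)) (hS : forall s, S s -> omonic lt s) :
  [<-> groebner_shirshov lt S;
       forall f, ideal_gen S f -> f <> 0 ->
         exists s u sbar,
           [/\ S s, leading lt s sbar & leading lt f (wsubst u sbar)];
       is_basis (fun w : irr lt S => opoly_class S << val w >>)].
Proof.
tfae.
- by move=> gsS f; apply: leading_reducible.
- move=> lead; split=> [c|x].
    by rewrite class_emb => /opoly_class_eq0 /irr_independent; apply.
  have [|c Sc] := @reduces_poly _ _ _ lt S (fun=> True) (repr x).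
    move=> v _; have [c Sc] := reduces_word hlt hS v; exists c.
    exact: span_below_mono Sc.
  exists c; rewrite class_emb -[LHS]opoly_classK; apply/opoly_classP/asboolP.
  exact: span_below_ideal Sc.
move=> [indep _] f g w h Sf Sg [u [gbar [fw gb wE hE]]].
apply/trivial_modE.
(* f and psubst u g are monic with leading word w, so w cancels in h. *)
have [|c Sc] := reduces_below hlt hS (w := w) (f := h).
  move=> v hv; have /leadingP[_ fmax] := fw.
  have /leadingP[_ gmax] := leading_psubst hlt u gb.
  have vw : v <> w.
    move=> vw; apply: hv; rewrite hE vw mcoeffB (monic_leading hlt hS Sf fw) wE.
    by rewrite (mcoeff_psubst hlt) (monic_leading hlt hS Sg gb) subrr.
  suff [] : v = w \/ lt v w by [].
  have [fv|/eqP/fmax //] := eqVneq f@_v 0.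
  rewrite wE; apply: gmax => gv; apply: hv.
  by rewrite hE mcoeffB fv gv subrr.
have hI : ideal_gen S h.
  move=> I idI SI; rewrite hE addrC -scaleN1r.
  by case: idI => _ Ilin Isub; apply: Ilin; [apply/Isub/SI | apply: SI].
suff c0 : c = 0 by rewrite c0 linear0 subr0 in Sc.
apply: indep; rewrite class_emb.
have /opoly_class_eq0 := span_below_ideal Sc.
move/opoly_class_eq0: hI; rewrite linearB /= => ->; rewrite sub0r => /eqP.
by rewrite oppr_eq0 => /eqP.
Qed.
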